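(* The rank function of any measurable matroid satisfies the rank axioms (R1)–(R5). Conversely, if $(J,\Sigma,\mu)$ is a standard measure space and $r\colon\Sigma\to\mathbb R_{\ge0}$ satisfies the rank axioms (R1)–(R5), then the family $$\mathcal F=\{F\in\Sigma\mid r(F)=\mu(F)\}$$ satisfies the independence axioms (I1)–(I4), and $(J,\Sigma,\mu,\mathcal F)$ is a measurable matroid with $r$ as its rank function.
   Context: A standard measure space $(J,\Sigma,\mu)$ is a standard Borel space $(J,\Sigma)$ with a finite atomless measure $\mu\colon\Sigma\to[0,\infty)$. Convention: measurable sets are identified when they differ by a $\mu$-null set: $A=B$ means $\mu(A\triangle B)=0$, $A\subseteq B$ means $\mu(A\setminus B)=0$, and families of measurable sets are families in the measure algebra (membership is unaffected by null modifications). All sets are assumed measurable. A set $X$ in a family $\mathcal X$ is maximal in $\mathcal X$ if $X\subseteq Y\in\mathcal X$ implies $Y\subseteq X$. Write $\mathcal X|Z=\{X\in\mathcal X\mid X\subseteq Z\}$. Independence axioms for $\mathcal F\subseteq\Sigma$: (I1) $\emptyset\in\mathcal F$; (I2) $F_1\subseteq F_2\in\mathcal F$ implies $F_1\in\mathcal F$; (I3) for all $X\in\Sigma$ and all maximal $F_1,F_2\in\mathcal F|X$, $\mu(F_1)=\mu(F_2)$; (I4) if $(F_i)_{i\in\mathbb N}$ is an increasing sequence in $\mathcal F$, then $\bigcup_i F_i\in\mathcal F$. A measurable matroid is a tuple $(J,\Sigma,\mu,\mathcal F)$ with $(J,\Sigma,\mu)$ a standard measure space and $\mathcal F$ satisfying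 (I1)–(I4). Its rank function is $r(X)=\mu(F)$ for any maximal $F\in\mathcal F|X$ (such $F$ exists and the value does not depend on the choice). Rank axioms for $r\colon\Sigma\to[0,\infty)$: (R1) $r(\emptyset)=0$; (R2) $r(X)\le r(Y)$ for all $X\subseteq Y$; (R3) $r(X)\le\mu(X)$ for all $X$; (R4) $r(X)+r(Y)\ge r(X\cap Y)+r(X\cup Y)$ for all $X,Y$; (R5) for all $X\subseteq Y$ with $r(X)=\mu(X)$, there exists $Z$ with $X\subseteq Z\subseteq Y$ and $r(Y)=r(Z)=\mu(Z)$. *)

(* Defs.v *)
From HB Require Import structures.
From mathcomp Require Import all_boot all_order all_algebra.
From mathcomp Require Import all_classical all_reals all_analysis.

Set Implicit Arguments.
Unset Strict Implicit.
Unset Printing Implicit Defensive.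

Import Order.TTheory GRing.Theory Num.Theory.

Local Open Scope classical_set_scope.
Local Open Scope ring_scope.
Local Open Scope ereal_scope.

Definition polish (R : realType) (P : metricType R) : Prop :=
  (forall F : set_system P, ProperFilter F -> cauchy F ->
     exists l : P, F --> l) /\
  (exists2 D : set P, countable D & dense D).

(* The measurable sets of J correspond, through a bijection onto a Polish space,
   to its Borel sets. The library's measurable types are pointed, so J is
   nonempty. *)
Definition standard_borel (R : realType) (d : measure_display)
    (J : measurableType d) : Prop :=
  exists (P : metricType R) (f : J -> P),
    [/\ polish P, bijective f &
        forall A : set J, measurable A <-> <<s open >> (f @` A)].

Section MeasurableMatroid.
Context (R : realType) (d : measure_display) (J : measurableType d).
Variable mu : {finite_measure set J -> \bar R}.

Definition atomless : Prop :=
  forall A : set J, measurable A -> 0 < mu A ->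
    exists B : set J, [/\ measurable B, B `<=` A, 0 < mu B & mu B < mu A].

Definition standard_measure_space : Prop := standard_borel R J /\ atomless.

(* Inclusion in the measure algebra; only used between measurable sets. *)
Definition ae_subset (X Y : set J) : Prop := mu (X `\` Y) = 0.

(* The family written X|Z in the literature. *)
Definition members_in (F : set (set J)) (Z : set J) : set (set J) :=
  [set X | F X /\ ae_subset X Z].

Definition maximal_in (F : set (set J)) (X : set J) : Prop :=
  F X /\ forall Y : set J, F Y -> ae_subset X Y -> ae_subset Y X.

(* Since inclusions are modulo null sets, (I2) entails that F is invariant
   under null modifications, i.e. is a family in the measure algebra. *)
Record independence_axioms (F : set (set J)) : Prop := {
  indep_measurable : F `<=` measurable;
  indep_I1 : F set0;
  indep_I2 : forall F1 F2 : set J, measurable F1 ->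
    ae_subset F1 F2 -> F F2 -> F F1;
  indep_I3 : forall X : set J, measurable X -> forall F1 F2 : set J,
    maximal_in (members_in F X) F1 -> maximal_in (members_in F X) F2 ->
    mu F1 = mu F2;
  indep_I4 : forall G : nat -> set J, (forall i, F (G i)) ->
    (forall i, ae_subset (G i) (G i.+1)) -> F (\bigcup_i G i)
}.

Definition measurable_matroid (F : set (set J)) : Prop :=
  standard_measure_space /\ independence_axioms F.

(* xget picks some maximal member of F|X; its default value set0 is never
   used for measurable X when F satisfies the independence axioms. *)
Definition rank (F : set (set J)) (X : set J) : R :=
  fine (mu (xget set0 [set G | maximal_in (members_in F X) G])).

(* A function on the sigma-algebra with values in [0, oo[ is represented by a
   real function on all sets whose values at nonmeasurable sets are irrelevant.
   By (R2) it is well defined on the measure algebra. *)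
Record rank_axioms (r : set J -> R) : Prop := {
  rank_ge0 : forall X : set J, measurable X -> (0 <= r X)%R;
  rank_R1 : r set0 = 0%R;
  rank_R2 : forall X Y : set J, measurable X -> measurable Y ->
    ae_subset X Y -> (r X <= r Y)%R;
  rank_R3 : forall X : set J, measurable X -> (r X)%:E <= mu X;
  rank_R4 : forall X Y : set J, measurable X -> measurable Y ->
    (r (X `&` Y) + r (X `|` Y) <= r X + r Y)%R;
  rank_R5 : forall X Y : set J, measurable X -> measurable Y ->
    ae_subset X Y -> (r X)%:E = mu X ->
    exists Z : set J, [/\ measurable Z, ae_subset X Z, ae_subset Z Y,
      r Y = r Z & (r Z)%:E = mu Z]
}.

Definition full_rank_sets (r : set J -> R) : set (set J) :=
  [set F | measurable F /\ (r F)%:E = mu F].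

End MeasurableMatroid.

(* Main.v *)
Require Import Defs.
From mathcomp Require Import all_boot all_order all_algebra.
From mathcomp Require Import all_classical all_reals all_analysis.
From mathcomp Require Import lra.

Import Order.TTheory GRing.Theory Num.Theory.
Import numFieldNormedType.Exports.

Local Open Scope classical_set_scope.
Local Open Scope ring_scope.
Local Open Scope ereal_scope.

(** The rank of a measurable matroid behaves like that of a finite matroid once
    independent subsets of X are known to extend to maximal ones. That fact,
    [maximal_extension], carries the passage from independence to rank. It is an
    exhaustion argument: enlarge the given set greedily, each time gaining at
    least half of the measure that can still be gained inside X
    ([greedy_extension]), and take the union, which is independent by (I4).
    Any independent superset of the union inside X has no more measure than the
    union, hence differs from it by a null set. All the rank axioms then follow
    by extending bases, with submodularity resulting from the modularity of the
    measure restricted to a basis of a union that extends a basis of the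
    intersection ([rank_of_matroid]).

    Conversely, (R5) says directly that a set of full rank inside X extends to
    one whose measure is r X. Thus maximal sets of full rank inside X exist
    ([maximal_exists]) and all have measure r X ([maximal_rank]); this is (I3)
    and identifies the rank. Heredity (I2) comes from submodularity together
    with r <= mu, and (I4) from the continuity of the measure
    ([matroid_of_rank]). *)

Section MeasurableMatroids.
Context {R : realType} {d : measure_display} {J : measurableType d}.
Variable mu : {finite_measure set J -> \bar R}.
Implicit Types (A B X Y Z : set J) (F : set (set J)) (G : nat -> set J).

Let m X : R := fine (mu X).

Lemma mE {X} : measurable X -> mu X = (m X)%:E.
Proof. by move=> mX; rewrite fineK// fin_num_measure. Qed.

(** * Inclusion modulo null sets *)

Lemma ae_subsetP {X Y} : measurable X -> measurable Y ->
  ae_subset mu X Y <-> mu.-negligible (X `\` Y).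
Proof. by move=> mX mY; rewrite negligibleP//; exact: measurableD. Qed.

Lemma subset_ae X Y : X `<=` Y -> ae_subset mu X Y.
Proof. by rewrite -setD_eq0 /ae_subset => ->; exact: measure0. Qed.

Lemma ae_subset_trans {Y X Z} :
    measurable X -> measurable Y -> measurable Z ->
  ae_subset mu X Y -> ae_subset mu Y Z -> ae_subset mu X Z.
Proof.
move=> mX mY mZ /(ae_subsetP mX mY) XY /(ae_subsetP mY mZ) YZ.
apply/(ae_subsetP mX mZ); apply: negligibleS (negligibleU XY YZ) => x [Xx nZx].
by have [Yx|nYx] := pselect (Y x); [right|left].
Qed.

Lemma bigcup_ae_subset G Z : (forall n, measurable (G n)) -> measurable Z ->
  (forall n, ae_subset mu (G n) Z) -> ae_subset mu (\bigcup_n G n) Z.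
Proof.
move=> mG mZ GZ; apply/ae_subsetP => //; first exact: bigcup_measurable.
rewrite setD_bigcupl; apply: negligible_bigcup => n; exact/ae_subsetP.
Qed.

Lemma ae_subsetU {X Y Z} : measurable X -> measurable Y -> measurable Z ->
  ae_subset mu X Z -> ae_subset mu Y Z -> ae_subset mu (X `|` Y) Z.
Proof.
move=> mX mY mZ /(ae_subsetP mX mZ) XZ /(ae_subsetP mY mZ) YZ.
apply/ae_subsetP => //; first exact: measurableU.
by rewrite setDUl; exact: negligibleU.
Qed.

Lemma ae_subsetI {X Y Z} : measurable X -> measurable Y -> measurable Z ->
  ae_subset mu X Y -> ae_subset mu X Z -> ae_subset mu X (Y `&` Z).
Proof.
move=> mX mY mZ /(ae_subsetP mX mY) XY /(ae_subsetP mX mZ) XZ.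
apply/ae_subsetP => //; first exact: measurableI.
by rewrite setDIr; exact: negligibleU.
Qed.

(** * The measure as a real-valued function *)

Lemma m_setDI {X Y} : measurable X -> measurable Y ->
  m X = (m (X `\` Y) + m (X `&` Y))%R.
Proof.
move=> mX mY; rewrite {1}/m (measureDI mu mX mY) fineD//.
  exact/fin_num_measure/measurableD.
exact/fin_num_measure/measurableI.
Qed.

(** This modularity of the measure is the source of submodularity (R4) of the
    rank. *)
Lemma m_modular {X Y} : measurable X -> measurable Y ->
  (m (X `|` Y) + m (X `&` Y) = m X + m Y)%R.
Proof.
move=> mX mY; have mXY := measurableU _ _ mX mY.
rewrite (m_setDI mXY mY) (m_setDI mX mY) setDUl setDv setU0.
have -> : (X `|` Y) `&` Y = Y by rewrite setIUl setIid; apply/setUidPr => x [].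
by lra.
Qed.

Lemma m_ge0 X : (0 <= m X)%R.
Proof. exact: fine_ge0. Qed.

Lemma m_le {X Y} : measurable X -> measurable Y -> ae_subset mu X Y ->
  (m X <= m Y)%R.
Proof.
move=> mX mY XY; rewrite (m_setDI mX mY) (m_setDI mY mX) setIC.
have -> : m (X `\` Y) = 0%R by rewrite /m XY.
by rewrite add0r lerDr m_ge0.
Qed.

(** For a finite measure an inclusion that does not increase the measure is an
    equality; this is how a comparison of measures yields maximality. *)
Lemma ae_subset_of_m_le {X Y} : measurable X -> measurable Y ->
  ae_subset mu X Y -> (m Y <= m X)%R -> ae_subset mu Y X.
Proof.
move=> mX mY XY; rewrite (m_setDI mX mY) (m_setDI mY mX) setIC.
have -> : m (X `\` Y) = 0%R by rewrite /m XY.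
rewrite lerD2r => mD.
rewrite /ae_subset mE; last exact: measurableD.
by congr _%:E; apply/eqP; rewrite eq_le mD m_ge0.
Qed.

(** Continuity from below, for sequences that increase only up to null sets. It
    is phrased as the preservation of an upper bound because both uses, the
    exhaustion argument and axiom (I4), need exactly this. *)
Lemma m_bigcup_le G (c : R) : (forall n, measurable (G n)) ->
  (forall n, ae_subset mu (G n) (G n.+1)) ->
  (forall n, m (G n) <= c)%R -> (m (\bigcup_n G n) <= c)%R.
Proof.
move=> mG GS Gc; pose H n := \big[setU/set0]_(i < n.+1) G i.
(* The partial unions H n increase pointwise and agree with G n up to null
   sets, so the continuity of the measure applies to them. *)
have mH n : measurable (H n) by exact: bigsetU_measurable.
have HG n : ae_subset mu (H n) (G n).
  rewrite /H; elim: n => [|n IH]; first by rewrite big_ord1; exact: subset_ae.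
  rewrite big_ord_recr; apply: ae_subsetU => //; first exact: (mH n).
    exact: (ae_subset_trans (mH n) (mG n)).
  exact: subset_ae.
rewrite -bigcup_bigsetU_bigcup -/H.
have mUH : measurable (\bigcup_n H n) by exact: bigcup_measurable.
have : (fine \o (mu \o H)) x @[x --> \oo] --> m (\bigcup_n H n).
  apply: fine_cvg; rewrite -mE//.
  apply: nondecreasing_cvg_mu => // i j ij; apply/subsetPset.
  exact: subset_bigsetU.
move/cvgr_to_le; apply; apply: nearW => n /=.
exact: le_trans (m_le (mH n) (mG n) (HG n)) (Gc n).
Qed.

(** * From independence axioms to rank axioms *)

Section RankOfMatroid.
Variable F : set (set J).
Hypothesis FI : independence_axioms mu F.

Let mF {X} : F X -> measurable X.
Proof. exact: (indep_measurable FI). Qed.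

(** One step of the exhaustion: H gains at least half of the measure that any
    extension of A inside X can gain. The inequality is
    m Y - m A <= 2 (m H - m A), written without subtraction. *)
Lemma greedy_extension X A : measurable X -> members_in mu F X A ->
  exists H, [/\ members_in mu F X H, ae_subset mu A H &
    forall Y, members_in mu F X Y -> ae_subset mu A Y ->
      (m Y + m A <= m H + m H)%R].
Proof.
move=> mX FA; pose E := [set m Y | Y in
  [set Y | members_in mu F X Y /\ ae_subset mu A Y]].
have EA : E (m A) by exists A => //; split => //; exact: subset_ae.
have ubE : has_ubound E.
  exists (m X) => _ [Y [[FY YX] _] <-]; exact: (m_le (mF FY) mX).
have supE : has_sup E by split => //; exists (m A).
have leE Y : members_in mu F X Y -> ae_subset mu A Y -> (m Y <= sup E)%R.
  by move=> FY GY; apply: ub_le_sup => //; exists Y.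
(* If the supremum is attained by A itself there is no slack below it, and
   A is already its own best extension. *)
have [sG|Gs] := leP (sup E) (m A).
  exists A; split => //; first exact: subset_ae.
  by move=> Y FY GY; rewrite lerD2r (le_trans _ sG)// leE.
have e0 : (0 < (sup E - m A) / 2)%R by lra.
have [_ [H [FH GH] <-] mH] := sup_adherent e0 supE.
by exists H; split => // Y FY GY; have := leE _ FY GY; lra.
Qed.

(** The measure replaces finiteness here: iterating the greedy step gives an
    increasing sequence whose union U is independent by (I4). An independent
    Y with U inside Y inside X is a competitor at every step, hence
    m Y + m (G n) <= 2 m (G n.+1) <= 2 m U, and letting n grow leaves
    m Y <= m U. *)
Lemma maximal_extension X A : measurable X -> members_in mu F X A ->
  exists H, maximal_in mu (members_in mu F X) H /\ ae_subset mu A H.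
Proof.
move=> mX FA.
have step (H : {H | members_in mu F X H}) :
    {H' : {H | members_in mu F X H} | ae_subset mu (sval H) (sval H') /\
      forall Y, members_in mu F X Y -> ae_subset mu (sval H) Y ->
        (m Y + m (sval H) <= m (sval H') + m (sval H'))%R}.
  case: H => H FH; apply: cid.
  have [H' [FH' HH' gr]] := greedy_extension X H mX FH.
  by exists (exist _ H' FH').
have [g [g0 gS]] := dependent_choice step (exist _ A FA).
pose G n := sval (g n).
have FG n : F (G n) by have [] := svalP (g n).
have GX n : ae_subset mu (G n) X by have [] := svalP (g n).
have mG n : measurable (G n) by exact: mF.
have GS n : ae_subset mu (G n) (G n.+1) by have [] := gS n.
have mU : measurable (\bigcup_n G n) by exact: bigcup_measurable.
have GU n : ae_subset mu (G n) (\bigcup_n G n).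
  by apply: subset_ae; exact: bigcup_sup.
exists (\bigcup_n G n); split; last first.
  by have -> : A = G 0%N by rewrite /G g0.
split=> [|Y FY UY].
  by split; [exact: (indep_I4 FI)|exact: bigcup_ae_subset].
have mY := mF (proj1 FY).
apply: ae_subset_of_m_le => //.
have : (m (\bigcup_n G n) <= m (\bigcup_n G n) + m (\bigcup_n G n) - m Y)%R.
  apply: m_bigcup_le => // n.
  have [_ /(_ Y FY (ae_subset_trans (mG n) mU mY (GU n) UY))] := gS n.
  rewrite -/(G n) -/(G n.+1).
  by have := m_le (mG n.+1) mU (GU n.+1); lra.
by lra.
Qed.

Lemma rankE X H : measurable X -> maximal_in mu (members_in mu F X) H ->
  rank mu F X = m H.
Proof.
move=> mX maxH; rewrite /rank /m; congr fine.
apply: (indep_I3 FI mX _ maxH).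
exact: (xgetPex set0 (ex_intro _ H maxH)).
Qed.

Lemma member_le_rank X H : measurable X -> members_in mu F X H ->
  (m H <= rank mu F X)%R.
Proof.
move=> mX FH; have [B [maxB HB]] := maximal_extension X H mX FH.
rewrite (rankE X B)//; apply: m_le => //; first exact: mF (proj1 FH).
exact: mF (proj1 (proj1 maxB)).
Qed.

Lemma empty_member X : members_in mu F X set0.
Proof. by split; [exact: indep_I1 FI|exact: subset_ae]. Qed.

Lemma members_inS X Y Z : measurable X -> measurable Y ->
  ae_subset mu X Y -> members_in mu F X Z -> members_in mu F Y Z.
Proof.
move=> mX mY XY [FZ ZX]; split => //.
exact: ae_subset_trans (mF FZ) mX mY ZX XY.
Qed.

(** (R2) and (R5) follow by extending independent sets to maximal ones.
    For (R4), extend a basis B of X `&` Y to a basis C of X `|` Y: the traces of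
    C on X and Y are independent, so r X + r Y is at least
    m (C `&` X) + m (C `&` Y) = m C + m (C `&` (X `&` Y)), which is at least
    m C + m B = r (X `|` Y) + r (X `&` Y). *)
Lemma rank_of_matroid : rank_axioms mu (rank mu F).
Proof.
have basis X : measurable X -> exists2 B, maximal_in mu (members_in mu F X) B &
    rank mu F X = m B.
  move=> mX; have [B [maxB _]] := maximal_extension X set0 mX (empty_member X).
  by exists B => //; exact: rankE.
split.
- by move=> X _; exact: m_ge0.
- have [B [[FB B0] _] ->] := basis _ measurable0.
  apply/eqP; rewrite eq_le m_ge0 andbT.
  have -> : 0%R = m set0 by rewrite /m measure0.
  exact: m_le (mF FB) _ B0.
- move=> X Y mX mY XY; have [B [FB _] ->] := basis X mX.
  by apply: member_le_rank => //; exact: members_inS FB.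
- move=> X mX; have [B [[FB BX] _] ->] := basis X mX.
  by rewrite mE// lee_fin; exact: m_le (mF FB) mX BX.
- move=> X Y mX mY.
  have mI := measurableI _ _ mX mY; have mU := measurableU _ _ mX mY.
  have [B [FB maxB] rI] := basis _ mI.
  have FBU : members_in mu F (X `|` Y) B.
    by apply: members_inS FB => //; apply: subset_ae => x [Xx _]; left.
  (* Extending B, rather than taking any basis of the union, is what makes C
     contain a basis of the intersection. *)
  have [C [maxC BC]] := maximal_extension _ B mU FBU.
  have [[FC CU] _] := maxC.
  have mB := mF (proj1 FB); have mC := mF FC.
  have part Z : measurable Z -> (m (C `&` Z) <= rank mu F Z)%R.
    move=> mZ; have mCZ := measurableI _ _ mC mZ; apply: member_le_rank => //.
    split; last by apply: subset_ae => x [].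
    by apply: (indep_I2 FI) FC => //; apply: subset_ae => x [].
  have := part X mX; have := part Y mY.
  have := m_modular (measurableI _ _ mC mX) (measurableI _ _ mC mY).
  rewrite -setIUr -setIIr rI (rankE _ C mU maxC).
  have : (m C <= m (C `&` (X `|` Y)))%R.
    apply: m_le => //; first exact: measurableI.
    by apply: ae_subsetI => //; exact: subset_ae.
  have : (m B <= m (C `&` (X `&` Y)))%R.
    apply: m_le => //; first exact: measurableI.
    by apply: ae_subsetI => //; exact: (proj2 FB).
  by lra.
- move=> X Y mX mY XY; rewrite mE// => -[rX].
  (* A basis of X of full measure is X up to a null set, so X is independent
     and can itself be extended. *)
  have FX : F X.
    have [B [[FB BX] _] rB] := basis X mX.
    apply: (indep_I2 FI mX _ FB); apply: ae_subset_of_m_le => //.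
      exact: mF.
    by rewrite -rB rX.
  have [Z [maxZ XZ]] := maximal_extension Y X mY (conj FX XY).
  have [[FZ ZY] _] := maxZ; have mZ := mF FZ.
  have rZ : rank mu F Z = m Z.
    apply: rankE => //; split=> [|W [_ WZ] _//].
    by split => //; exact: subset_ae.
  by exists Z; split => //; [rewrite rZ; exact: rankE|rewrite mE// rZ].
Qed.

End RankOfMatroid.

(** * From rank axioms to independence axioms *)

Section MatroidOfRank.
Variable r : set J -> R.
Hypothesis rR : rank_axioms mu r.

Let F : set (set J) := full_rank_sets mu r.

Let FP {X} : F X <-> measurable X /\ r X = m X.
Proof.
by split=> [[mX]|[mX rX]]; [rewrite mE// => -[]|split; rewrite // mE// rX].
Qed.

Let r_le_m {X} : measurable X -> (r X <= m X)%R.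
Proof. by move=> mX; have := rank_R3 rR mX; rewrite mE// lee_fin. Qed.

(** (R5) enlarges B to a set Z of full rank inside X with m Z = r X, and
    maximality forces Z to be B up to a null set. The value r X depends only on
    X, which gives both (I3) and the agreement of the rank with r. *)
Lemma maximal_rank X B : measurable X ->
  maximal_in mu (members_in mu F X) B -> m B = r X.
Proof.
move=> mX [[/[dup] FB /FP[mB rB] BX] maxB].
have [Z [mZ BZ ZX rXZ rZ]] := rank_R5 rR mB mX BX (proj2 FB).
have FZ : F Z by split.
have ZB := maxB Z (conj FZ ZX) BZ.
move/FP: FZ => [_ rmZ]; rewrite rXZ rmZ.
by apply/eqP; rewrite eq_le !m_le.
Qed.

(** (R5) applied to the empty set already produces a set of full rank of
    measure r X, and by (R2) no larger set of full rank fits inside X. *)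
Lemma maximal_exists X : measurable X ->
  exists B, maximal_in mu (members_in mu F X) B.
Proof.
move=> mX; have r0 : (r set0)%:E = mu set0 by rewrite (rank_R1 rR) measure0.
have [|Z [mZ _ ZX rXZ rZ]] := rank_R5 rR measurable0 mX _ r0.
  exact: subset_ae.
have FZ : F Z by split.
exists Z; split=> [//|Y [/FP[mY rY] YX] ZY].
move/FP: FZ => [_ rmZ].
by apply: ae_subset_of_m_le => //; rewrite -rY -rmZ -rXZ; exact: (rank_R2 rR).
Qed.

(** (I2) holds because r loses at most as much as m on a removed piece: by (R4)
    and (R3), m Y = r Y <= r (Y `&` X) + m (Y `\` X). For (I4), monotonicity
    bounds r of the union below by every m (G n), hence by their limit. *)
Lemma matroid_of_rank : independence_axioms mu F.
Proof.
split.
- by move=> X [].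
- by split; rewrite // (rank_R1 rR) measure0.
- move=> X Y mX XY /FP[mY rY]; apply/FP; split => //.
  (* X lies in Y only up to a null set, so the splitting of Y is done along
     Y `&` X, which has the same measure and rank as X. *)
  have mI := measurableI _ _ mY mX; have mD := measurableD mY mX.
  have XI : ae_subset mu X (Y `&` X).
    by apply: ae_subsetI => //; exact: subset_ae.
  have rI : (r (Y `&` X) <= r X)%R.
    by apply: (rank_R2 rR) => //; exact: subset_ae.
  apply/eqP; rewrite eq_le r_le_m//=; apply: le_trans rI.
  have := m_le mX mI XI; have := r_le_m mD; have := m_setDI mY mX.
  have := rank_R4 rR mD mI; rewrite setUC setUIDK rY.
  have -> : (Y `\` X) `&` (Y `&` X) = set0.
    by apply/seteqP; split=> x // [[_ nXx] [_ /nXx]].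
  rewrite (rank_R1 rR); lra.
- move=> X mX B1 B2 max1 max2.
  have [[/FP[m1 _] _] _] := max1; have [[/FP[m2 _] _] _] := max2.
  by rewrite !mE// (maximal_rank X B1)// (maximal_rank X B2).
- move=> G FG GS; have mG n : measurable (G n) by have [] := FG n.
  have mU : measurable (\bigcup_n G n) by exact: bigcup_measurable.
  apply/FP; split => //; apply/eqP; rewrite eq_le r_le_m//=.
  apply: m_bigcup_le => // n; have /FP[_ <-] := FG n.
  by apply: (rank_R2 rR) => //; apply: subset_ae; exact: bigcup_sup.
Qed.

Lemma rank_of_full_rank_sets X : measurable X -> rank mu F X = r X.
Proof.
move=> mX; have [B maxB] := maximal_exists X mX.
by rewrite (rankE F matroid_of_rank X B)// (maximal_rank X).
Qed.

End MatroidOfRank.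

End MeasurableMatroids.

Theorem theorem2p18 (R : realType) (d : measure_display)
    (J : measurableType d) (mu : {finite_measure set J -> \bar R}) :
  (forall F : set (set J),
     measurable_matroid mu F -> rank_axioms mu (rank mu F)) /\
  (forall r : set J -> R,
     standard_measure_space mu -> rank_axioms mu r ->
     [/\ independence_axioms mu (full_rank_sets mu r),
         measurable_matroid mu (full_rank_sets mu r) &
         forall X : set J, measurable X ->
           rank mu (full_rank_sets mu r) X = r X]).
Proof.
split=> [F [_]|r std rR]; first exact: rank_of_matroid.
have FI := matroid_of_rank mu r rR.
by split => //; exact: rank_of_full_rank_sets.
Qed.
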